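(* For every positive integer $n$, $$ \sigma(n)=n\sum_{r=1}^{n}\frac{(-1)^{r-1}}{r}\binom{n}{r}\,p_{-r}(n). $$
   Context: For a positive integer $n$, $\sigma(n)=\sum_{d\mid n}d$ is the sum of the positive divisors of $n$. For a positive integer $r$, $p_{-r}(n)$ is the number of $r$-coloured partitions of $n$, i.e. partitions of $n$ in which each part can occur in $r$ colours. Equivalently, $\sum_{n=0}^{\infty}p_{-r}(n)q^{n}=E(q)^{-r}$, where $E(q)=\prod_{j=1}^{\infty}(1-q^{j})$ and $|q|<1$. *)

(* Defs.v *)
From mathcomp Require Import all_boot all_order all_algebra.

Set Implicit Arguments.
Unset Strict Implicit.
Unset Printing Implicit Defensive.

Definition sigma (n : nat) : nat := \sum_(d <- divisors n) d.

(* A partition of n in r colours is encoded by its multiplicities: m (i, c) is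
   the number of times the part i.+1 occurs in colour c.  Every part of a
   partition of n lies in {1, ..., n} and occurs at most n times, so these
   bounds exclude nothing. *)
Definition colored_partitions (r n : nat) : {set {ffun 'I_n * 'I_r -> 'I_n.+1}} :=
  [set m : {ffun 'I_n * 'I_r -> 'I_n.+1} |
    (\sum_(ic : 'I_n * 'I_r) ic.1.+1 * m ic == n)%N].

(* p_{-r}(n) *)
Definition num_colored_partitions (r n : nat) : nat :=
  #|colored_partitions r n|.

(* Main.v *)
Require Import Defs.
From mathcomp Require Import all_boot all_order all_algebra.
From mathcomp Require Import ring.

(** Let [P = E(q)^-1], so that [P ^ r] generates the partitions in [r] colours.
The logarithmic derivative of [P] is [q P' / P = S], the generating function of
[sigma], hence [q (P ^ r)' = r S P ^ r], and at [q ^ n] this reads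
[n p_{-r}(n) = r [q ^ n] (S P ^ r)].  The factor [r] cancels the [1 / r] of the
sum to be evaluated, which becomes the coefficient of [q ^ n] in
[S * \sum_(1 <= r <= n) (-1) ^ (r - 1) 'C(n, r) P ^ r = S * (1 - (1 - P) ^ n)].
Both [S] and [1 - P] are divisible by [q], so [S (1 - P) ^ n] is divisible by
[q ^ (n + 1)] and only [[q ^ n] S = sigma(n)] remains.

Since only coefficients up to [q ^ n] matter, the series are replaced by
polynomials: [P] is the product of the truncated geometric series
[geom n d = \sum_(k <= n) 'X^(d * k)] for [1 <= d <= n], and identities between
logarithmic derivatives hold modulo ['X^(n.+1)].  The ingredients are
[coef_partition_polyX] (the coefficient of [P ^ r] counts coloured partitions),
[log_deriv_mod_geom] (the logarithmic derivative of one factor) and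
[coef_sigma_poly] (the sum of these yields [sigma]). *)

Import GRing.Theory.
Local Open Scope ring_scope.

(** [S] is the logarithmic derivative of [A] for the derivation [q d/dq], modulo
['X^N]; clearing the denominator [A] keeps the condition inside the polynomial
ring.  Using [q d/dq] instead of [d/dq] avoids any shift of degrees: it
multiplies the coefficient of index [m] by [m]. *)
Definition log_deriv_mod (N : nat) (A S : {poly rat}) : bool :=
  'X^N %| 'X * A^`() - S * A.

Lemma log_deriv_mod1 N : log_deriv_mod N 1 0.
Proof. by rewrite /log_deriv_mod derivC mulr0 mul0r subrr dvdp0. Qed.

Lemma log_deriv_modM {N A B S T} :
  log_deriv_mod N A S -> log_deriv_mod N B T ->
  log_deriv_mod N (A * B) (S + T).
Proof.
rewrite /log_deriv_mod => hA hB.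
have -> : 'X * (A * B)^`() - (S + T) * (A * B) =
    ('X * A^`() - S * A) * B + A * ('X * B^`() - T * B).
  by rewrite derivM; ring.
by apply: dvdp_add; [apply: dvdp_mulr | apply: dvdp_mull].
Qed.

Lemma log_deriv_mod_prod {N} {I : finType} {A S : I -> {poly rat}} :
  (forall i, log_deriv_mod N (A i) (S i)) ->
  log_deriv_mod N (\prod_i A i) (\sum_i S i).
Proof.
move=> hAS; apply: (big_ind2 (log_deriv_mod N)) => //.
  exact: log_deriv_mod1.
by move=> *; apply: log_deriv_modM.
Qed.

Lemma log_deriv_modX {N A S} r :
  log_deriv_mod N A S -> log_deriv_mod N (A ^+ r) (S *+ r).
Proof.
move=> hA; elim: r => [|r IHr]; first exact: log_deriv_mod1.
by rewrite exprS mulrS; apply: log_deriv_modM.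
Qed.

Lemma coef_log_deriv_mod {N A S m} :
  log_deriv_mod N A S -> (m < N)%N -> m%:R * A`_m = (S * A)`_m.
Proof.
case/dvdpP=> Q hQ ltmN; have := congr1 (fun p : {poly rat} => p`_m) hQ.
rewrite coefB coefMXn ltmN coefXM => /eqP; rewrite subr_eq0 => /eqP <-.
case: m ltmN => [|m] _ /=; first by rewrite mul0r.
by rewrite coef_deriv mulr_natl.
Qed.

Definition geom (N d : nat) : {poly rat} := \sum_(k < N.+1) 'X^(d * k).

(** Up to ['X^(N.+1)], [geom N d] is [1 / (1 - Y)] with [Y = 'X^d], whose
logarithmic derivative is [d Y / (1 - Y) = d (1 / (1 - Y) - 1)]. *)
Lemma log_deriv_mod_geom N d :
  (0 < d)%N -> log_deriv_mod N.+1 (geom N d) (d%:R * (geom N d - 1)).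
Proof.
move=> d_gt0; rewrite /log_deriv_mod; set g := geom N d.
set Y : {poly rat} := 'X^d.
(* The error term is computed after multiplication by [Y - 1], which is
   invertible modulo a power of 'X and makes the truncated series explicit. *)
have hg : (Y - 1) * g = Y ^+ N.+1 - 1.
  by rewrite (subrX1 Y N.+1); congr (_ * _); apply: eq_bigr => k _; rewrite exprM.
have hY m : 'X * (Y ^+ m)^`() = (d * m)%:R * Y ^+ m.
  rewrite -exprM derivXn; case: (d * m)%N => [|e]; first by rewrite mulr0 mul0r.
  by rewrite mulrnAr -exprS mulr_natl.
have coYX : coprimep 'X^(N.+1) (Y - 1).
  apply: coprimep_expl; rewrite -['X]subr0 coprimep_sym coprimep_XsubC.
  by rewrite rootE !hornerE expr0n eqn0Ngt d_gt0 sub0r oppr_eq0 oner_eq0.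
rewrite -(Gauss_dvdpr _ coYX).
have hdg : 'X * ((Y - 1) * g)^`() = (d * N.+1)%:R * Y ^+ N.+1.
  by rewrite hg derivB derivC subr0 hY.
have -> : (Y - 1) * ('X * g^`() - d%:R * (g - 1) * g) =
          d%:R * (N.+1%:R - g) * Y ^+ N.+1.
  have hY1 := hY 1%N; rewrite muln1 !expr1 in hY1.
  have -> : (Y - 1) * ('X * g^`() - d%:R * (g - 1) * g) =
     'X * ((Y - 1) * g)^`() - ('X * Y^`()) * g - d%:R * (g - 1) * ((Y - 1) * g).
    by rewrite derivM derivB derivC; ring.
  rewrite hdg hY1 natrM.
  have -> : d%:R * N.+1%:R * Y ^+ N.+1 - d%:R * Y * g - d%:R * (g - 1) * ((Y - 1) * g)
    = d%:R * N.+1%:R * Y ^+ N.+1 - d%:R * ((Y - 1) * g) - d%:R * g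
      - d%:R * (g - 1) * ((Y - 1) * g) by ring.
  by rewrite hg; ring.
by rewrite dvdp_mull // -exprM dvdp_exp2l // leq_pmull.
Qed.

Lemma coef_geom {N d m} : (0 < d)%N -> (m <= N)%N -> (geom N d)`_m = (d %| m)%N%:R.
Proof.
move=> d_gt0 lemN; rewrite coef_sum.
under eq_bigr => k _ do rewrite coefXn.
case: (boolP (d %| m)%N) => [/dvdnP[k mE]|ndm]; last first.
  rewrite big1 // => k _; case: eqP => // mE.
  by rewrite mE dvdn_mulr in ndm.
have ltkN : (k < N.+1)%N.
  by rewrite ltnS (leq_trans _ lemN) // mE leq_pmulr.
rewrite (bigD1 (Ordinal ltkN)) //= mE mulnC eqxx big1 ?addr0 // => j.
rewrite -val_eqE /= eqn_pmul2l // eq_sym.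
by move=> /negbTE ->.
Qed.

(** Parts and multiplicities are both cut off at [n], exactly as in
[colored_partitions]. *)
Definition partition_poly (n : nat) : {poly rat} := \prod_(i < n) geom n i.+1.

(** Kept as a sum of logarithmic derivatives of the factors of
[partition_poly n]; it agrees with [\sum_(m > 0) sigma(m) q ^ m] only up to
['X^n]. *)
Definition sigma_poly (n : nat) : {poly rat} :=
  \sum_(i < n) i.+1%:R * (geom n i.+1 - 1).

(** Expanding the product of the [n * r] geometric sums, one for each coloured
part, amounts to choosing a multiplicity for every coloured part.  The cut-offs
agree on both sides, so the monomials of degree [n] are in bijection with the
coloured partitions of [n]. *)
Lemma coef_partition_polyX n r :
  (partition_poly n ^+ r)`_n = (num_colored_partitions r n)%:R.
Proof.
have -> : partition_poly n ^+ r =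
    \prod_(ic : 'I_n * 'I_r) \sum_(k < n.+1) 'X^(ic.1.+1 * k).
  rewrite -(pair_bigA _ (fun (i : 'I_n) (c : 'I_r) => geom n i.+1)) /=.
  by rewrite -prodrXl; apply: eq_bigr => i _; rewrite prodr_const card_ord.
rewrite bigA_distr_bigA coef_sum /num_colored_partitions -sum1_card natr_sum.
rewrite [RHS]big_mkcond; apply: eq_bigr => m _.
by rewrite inE -expr_sum coefXn eq_sym; case: eqP.
Qed.

Lemma dvdX_coef0 (p : {poly rat}) : p`_0 = 0 -> 'X %| p.
Proof. by move=> p0; rewrite -['X]subr0 dvdp_XsubCl rootE horner_coef0 p0. Qed.

Lemma dvdX_geomB1 N d : (0 < d)%N -> 'X %| geom N d - 1.
Proof.
by move=> d0; apply: dvdX_coef0; rewrite coefB coef_geom // dvdn0 coef1 subrr.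
Qed.

Lemma dvdX_sigma_poly n : 'X %| sigma_poly n.
Proof.
rewrite /sigma_poly; elim/big_ind: _ => [|p q|i _]; [exact: dvdp0|exact: dvdp_add|].
by rewrite dvdp_mull ?dvdX_geomB1.
Qed.

Lemma dvdX_partition_poly n : 'X %| 1 - partition_poly n.
Proof.
apply: dvdX_coef0; rewrite coefB coef1 -horner_coef0 horner_prod.
rewrite big1 ?subrr // => i _.
by rewrite horner_coef0 coef_geom ?dvdn0.
Qed.

(** The coefficient of ['X^n] in [geom n d - 1] is [1] or [0] according to
whether [d] divides [n]. *)
Lemma coef_sigma_poly n : (0 < n)%N -> (sigma_poly n)`_n = (sigma n)%:R.
Proof.
move=> n_gt0; rewrite coef_sum.
transitivity (\sum_(i < n) (if (i.+1 %| n)%N then i.+1%:R else 0) : rat).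
  apply: eq_bigr => i _; rewrite mulr_natl coefMn coefB coef_geom // coef1.
  by rewrite gtn_eqF // subr0; case: (_ %| _)%N; rewrite ?mul0rn.
rewrite -big_mkcond /= /sigma natr_sum.
rewrite -(big_mkord (fun i => i.+1 %| n)%N (fun i => i.+1%:R)).
rewrite -(big_add1 _ _ 0%N n.+1 (fun d => d %| n)%N (fun d => d%:R)).
rewrite -big_filter; apply: perm_big; apply: uniq_perm.
- by rewrite filter_uniq ?iota_uniq.
- exact: divisors_uniq.
move=> d; rewrite mem_filter mem_index_iota -dvdn_divisors // ltnS.
by case: (boolP (d %| n)%N) => ddn; rewrite ?andbF // (dvdn_gt0 n_gt0 ddn) (dvdn_leq n_gt0 ddn).
Qed.

(** The binomial expansion of [(1 - x) ^ n] without its constant term, with the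
signs of the main identity; the theorem uses it at [x = partition_poly n], where
[1 - x] has no constant term. *)
Lemma sum_alternating_binomial (R : comNzRingType) n (x : R) :
  \sum_(1 <= r < n.+1) ((-1) ^+ r.-1 * 'C(n, r)%:R) * x ^+ r = 1 - (1 - x) ^+ n.
Proof.
rewrite (exprBn _ _ n).
rewrite -(big_mkord xpredT (fun i => ((-1) ^+ i * 1 ^+ (n - i) * x ^+ i) *+ 'C(n, i))).
rewrite big_ltn // bin0 expr0 !expr1n !mulr1 mulr1n opprD addrA subrr add0r.
rewrite -sumrN; apply: eq_big_nat => -[|r] // _.
by rewrite /= expr1n mulr1 (exprS (-1)) mulN1r mulNr mulNrn opprK mulr_natr mulrnAl.
Qed.

Theorem theorem2 (n : nat) (n_gt0 : (0 < n)%N) :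
  (sigma n)%:R =
    n%:R * \sum_(1 <= r < n.+1)
             (-1) ^+ r.-1 / r%:R * 'C(n, r)%:R
               * (num_colored_partitions r n)%:R :> rat.
Proof.
set P := partition_poly n; set S := sigma_poly n.
have hP : log_deriv_mod n.+1 P S.
  by apply: log_deriv_mod_prod => i; apply: log_deriv_mod_geom.
transitivity (S * (1 - (1 - P) ^+ n))`_n.
  (* Each of the n + 1 factors contributes one power of 'X. *)
  have /dvdpP[Q hQ] : 'X^(n.+1) %| S * (1 - P) ^+ n.
    by rewrite exprS dvdp_mul ?dvdX_sigma_poly ?dvdp_exp2r ?dvdX_partition_poly.
  by rewrite mulrBr mulr1 hQ coefB coefMXn ltnSn subr0 coef_sigma_poly.
rewrite -sum_alternating_binomial !mulr_sumr coef_sum.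
apply: eq_big_nat => r /andP[r_gt0 _].
have r_neq0 : r%:R != 0 :> rat by rewrite Num.Theory.pnatr_eq0 -lt0n.
have := coef_log_deriv_mod (log_deriv_modX r hP) (ltnSn n).
rewrite coef_partition_polyX [_ *+ r * _]mulrnAl coefMn -[X in _ = X]mulr_natr => hr.
rewrite mulrCA -(rmorph1 polyC) -rmorphN -rmorphXn -(rmorph_nat polyC) -rmorphM coefCM.
(* Trade the coefficient of S * P ^+ r for n * p_{-r}(n) / r. *)
rewrite -[(S * _)`_n](mulfK r_neq0) -hr.
by ring.
Qed.
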